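(* Let $X$ be a Bernoulli random variable with mean $\mu\in(0,1)$, let $\gamma$ be a positive integer, and let $\delta\in(0,1)$. Let $\overline{\boldsymbol{\mu}}$ be the random variable such that $\overline{\boldsymbol{\mu}}=1$ when $\boldsymbol{n}=\gamma$, and $$H\left(\frac{\gamma}{\boldsymbol{n}},\overline{\boldsymbol{\mu}}\right)=\frac{\ln\frac{\delta}{2}}{\gamma},\qquad \frac{\gamma}{\boldsymbol{n}}<\overline{\boldsymbol{\mu}}<1$$ when $\boldsymbol{n}>\gamma$. Let $\underline{\boldsymbol{\mu}}$ be the random variable such that $$H\left(\frac{\gamma}{\boldsymbol{n}},\underline{\boldsymbol{\mu}}\right)=\frac{\ln\frac{\delta}{2}}{\gamma},\qquad 0<\underline{\boldsymbol{\mu}}<\frac{\gamma}{\boldsymbol{n}}.$$ Then $$\Pr\{\underline{\boldsymbol{\mu}}<\mu<\overline{\boldsymbol{\mu}}\}\ge 1-\delta.$$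
   Context: $X_1,X_2,\ldots$ are i.i.d. samples of the Bernoulli random variable $X$ (values in $\{0,1\}$, $\Pr\{X=1\}=\mu$). Inverse (binomial) sampling with threshold $\gamma$: sampling continues until the sample sum is no less than $\gamma$, and $\boldsymbol{n}$ is the (random) sample size at stopping, i.e. the smallest positive integer $n$ such that $\sum_{i=1}^{n}X_i\ge\gamma$ (it is finite almost surely, and $\boldsymbol{n}\ge\gamma$). For $0<z<1$ and $0<\mu<1$, $$H(z,\mu)=\ln\left(\frac{\mu}{z}\right)+\left(\frac1z-1\right)\ln\left(\frac{1-\mu}{1-z}\right),$$ and, by continuity, $H(1,\mu)=\ln\mu$ for $0<\mu<1$ (used when $\boldsymbol{n}=\gamma$). *)

(* Defs.v *)
From HB Require Import structures.
From mathcomp Require Import all_boot all_order all_algebra.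
From mathcomp Require Import all_classical all_reals all_analysis.

Set Implicit Arguments.
Unset Strict Implicit.
Unset Printing Implicit Defensive.

Import Order.TTheory GRing.Theory Num.Theory.
Import numFieldNormedType.Exports.

Local Open Scope classical_set_scope.
Local Open Scope ring_scope.

Definition mutually_independent (d d' : measure_display)
    (T : measurableType d) (T' : measurableType d') (R : realType)
    (P : probability T R) (I : eqType) (X : I -> {RV P >-> T'}) : Prop :=
  forall (s : seq I) (A : I -> set T'), uniq s ->
    (forall i, measurable (A i)) ->
    P (\bigcap_(i in [set` s]) (X i @^-1` A i)) =
    (\prod_(i <- s) P (X i @^-1` A i))%E.

Definition iid_bernoulli (d : measure_display) (T : measurableType d)
    (R : realType) (P : probability T R) (X : nat -> {RV P >-> bool})
    (mu : R) : Prop :=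
  mutually_independent X /\
  forall i, distribution P (X i) = bernoulli_prob mu :> (set bool -> \bar R).

(* The sequence is indexed from 0, so the sum of the first n samples is the sum
   over i < n. The value None means that the sum never reaches gamma; it occurs
   with probability 0 for i.i.d. Bernoulli samples with positive mean. *)
Definition inverse_sample_size (x : nat -> bool) (gamma : nat) : option nat :=
  if pselect (exists n, (0 < n)%N && (gamma <= \sum_(i < n) x i)%N) is left h
  then Some (ex_minn h) else None.

(* The value at z = 1 is the limit of the general formula as z tends to 1. *)
Definition H (R : realType) (z mu : R) : R :=
  if z == 1 then ln mu
  else ln (mu / z) + (z^-1 - 1) * ln ((1 - mu) / (1 - z)).

(* Main.v *)
(* Write S_N for the sum of the first N samples and z = gamma / N. Replacing
   the success probability mu by z multiplies the likelihood of every outcome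
   of the first N samples with (S_N - gamma) (z - mu) >= 0 by at least exp (-
   gamma H(z, mu)), so this event has probability at most exp (gamma H(z,
   mu)). Since H(z, .) increases up to z and decreases afterwards, mu >=
   mu_upper forces gamma / n < mu and H(gamma / n, mu) <= ln (delta / 2) /
   gamma; if N is the least n with these two properties, then n >= N, hence
   S_N <= gamma, an event of probability at most delta / 2. It also contains
   the outcomes for which sampling never stops. Symmetrically, mu <= mu_lower
   forces S_M >= gamma, where M is the largest n with mu < gamma / n and the
   same bound on H. *)

Require Import Defs.
From mathcomp Require Import all_boot all_order all_algebra.
From mathcomp Require Import all_classical all_reals all_analysis.
From mathcomp Require Import ring lra.

Set Implicit Arguments.
Unset Strict Implicit.
Unset Printing Implicit Defensive.

Import Order.TTheory GRing.Theory Num.Theory.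

Local Open Scope classical_set_scope.
Local Open Scope ring_scope.

(** * Monotonicity of [H] and comparison of likelihoods *)

Lemma ln_sub_le (R : realType) (x y : R) :
  0 < x -> 0 < y -> ln x - ln y <= (x - y) / y.
Proof.
move=> x0 y0; rewrite -ln_div ?posrE// mulrBl divff ?gt_eqF//.
have := @le_ln1Dx R (x / y - 1); rewrite subrKC; apply.
by rewrite ltrBDl subrr divr_gt0.
Qed.

(* At z = 1 the factor 1/z - 1 kills the junk value ln 0 = 0. *)
Lemma H_lnE (R : realType) (z m : R) : 0 < z <= 1 -> 0 < m < 1 ->
  H z m = ln m - ln z + (z^-1 - 1) * (ln (1 - m) - ln (1 - z)).
Proof.
move=> /andP[z0 z1] /andP[m0 m1]; rewrite /H.
have [->|zn1] := eqVneq z 1; first by rewrite ln1 invr1 !subrr mul0r subr0 addr0.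
have z1' : z < 1 by rewrite lt_neqAle zn1.
by rewrite !ln_div ?posrE ?subr_gt0.
Qed.

(** The last hypothesis places [a] between [z] and [b], which treats both sides of the maximum at
    [z] at once. Bounding both logarithms by their tangents at [a] gives [H z b - H z a <= - (b - a)
    * (a - z) / (a * z * (1 - a))]. *)
Lemma H_le (R : realType) (z a b : R) : 0 < z <= 1 -> 0 < a < 1 -> 0 < b < 1 ->
  0 <= (b - a) * (a - z) -> H z b <= H z a.
Proof.
move=> z01 a01 b01 abz; rewrite !H_lnE//.
case/andP: z01 => z0 z1; case/andP: a01 => a0 a1; case/andP: b01 => b0 b1.
have zV : 0 <= z^-1 - 1 by rewrite subr_ge0 invf_ge1.
have lnab := ln_sub_le b0 a0.
have lnab' : ln (1 - b) - ln (1 - a) <= (a - b) / (1 - a).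
  rewrite (_ : a - b = (1 - b) - (1 - a)); last by ring.
  by apply: ln_sub_le; rewrite subr_gt0.
have := ler_wpM2l zV lnab'.
suff : (b - a) / a + (z^-1 - 1) * ((a - b) / (1 - a)) <= 0 by lra.
rewrite (_ : _ + _ = - ((b - a) * (a - z) / (a * z * (1 - a)))).
  by rewrite oppr_le0 divr_ge0// !mulr_ge0 ?subr_ge0 ?(ltW a0) ?(ltW z0) ?(ltW a1).
field; rewrite (gt_eqF a0) (gt_eqF z0) subr_eq0 eq_sym lt_eqF//.
Qed.

(** For [z = g / N < 1], the logarithms of the two sides differ by [(k - g) * D], where [D] is the
    log-odds of [m] minus the log-odds of [z]. Log-odds increase, so [D] has the sign of [m - z] and
    the last hypothesis makes the product nonpositive. *)
Lemma likelihood_le (R : realType) (m : R) (g N k : nat) :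
  0 < m < 1 -> (0 < g <= N)%N -> (k <= N)%N ->
  0 <= (k%:R - g%:R) * (g%:R / N%:R - m) ->
  m ^+ k * (1 - m) ^+ (N - k) <=
  expR (g%:R * H (g%:R / N%:R) m) *
    ((g%:R / N%:R) ^+ k * (1 - g%:R / N%:R) ^+ (N - k)).
Proof.
move=> m01 /andP[g0 gN] kN; set z := g%:R / N%:R.
have N0 : 0 < N%:R :> R by rewrite ltr0n (leq_trans g0).
have g0' : 0 < g%:R :> R by rewrite ltr0n.
have z0 : 0 < z by rewrite divr_gt0.
have z1 : z <= 1 by rewrite ler_pdivrMr// mul1r ler_nat.
have /andP[m0 m1] := m01.
have gH : g%:R * H z m = g%:R * (ln m - ln z) + (N - g)%:R * (ln (1 - m) - ln (1 - z)).
  rewrite H_lnE ?z0// mulrDr mulrA; congr (_ + _ * _).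
  by rewrite natrB// /z invf_div mulrBr mulr1 mulrCA divff ?gt_eqF// mulr1.
have e1 : m ^+ k * (1 - m) ^+ (N - k) = expR (k%:R * ln m + (N - k)%:R * ln (1 - m)).
  by rewrite expRD !expRM_natl !lnK ?posrE// subr_gt0.
(* At [z = 1] the factor [1 - z] vanishes and is not the exponential of its logarithm. There
   [g = N], and the sign condition forces [k = N], so both sides equal [m ^+ N]. *)
have := z1; rewrite le_eqVlt => /predU1P[zE|zlt] kgz.
  have gEN : g = N.
    apply/eqP; rewrite -(eqr_nat R) -subr_eq0; apply/eqP.
    by move: zE; rewrite /z => /(congr1 ( *%R^~ N%:R)); rewrite divfK ?gt_eqF// mul1r => ->;
      rewrite subrr.
  have kEN : k = N.
    apply/eqP; rewrite eqn_leq kN -gEN -(ler_nat R) -subr_ge0.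
    by rewrite -(pmulr_lge0 _ (_ : 0 < z - m)) ?zE ?subr_gt0//; rewrite zE in kgz.
  by rewrite e1 gH zE kEN gEN subnn ln1 subr0 expr1n expr0 !mul0r addr0 !mulr1 lexx.
have e2 : z ^+ k * (1 - z) ^+ (N - k) = expR (k%:R * ln z + (N - k)%:R * ln (1 - z)).
  by rewrite expRD !expRM_natl !lnK ?posrE// subr_gt0.
rewrite e1 e2 -expRD ler_expR gH !natrB//.
set D := (ln m - ln z) - (ln (1 - m) - ln (1 - z)).
suff : (k%:R - g%:R) * D <= 0 by rewrite /D; lra.
have [mz|mz|mz] := ltgtP m z.
- have : 0 <= k%:R - g%:R :> R by rewrite -(pmulr_lge0 _ (_ : 0 < z - m)) ?subr_gt0.
  move=> kg; rewrite mulr_ge0_le0// /D.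
  have : ln m <= ln z by rewrite ler_ln ?posrE// ltW.
  have : ln (1 - z) <= ln (1 - m) by rewrite ler_ln ?posrE ?subr_gt0// lerD2l lerN2 ltW.
  lra.
- have : k%:R - g%:R <= 0 :> R by rewrite -(nmulr_lge0 _ (_ : z - m < 0)) ?subr_lt0.
  move=> kg; rewrite mulr_le0_ge0// /D.
  have : ln z <= ln m by rewrite ler_ln ?posrE// ltW.
  have : ln (1 - m) <= ln (1 - z) by rewrite ler_ln ?posrE ?subr_gt0// lerD2l lerN2 ltW.
  lra.
- by rewrite /D mz !subrr mulr0.
Qed.

(** * Tail bound for the sum of the first [N] samples *)

Lemma prod_bernoulli_pmf (R : realType) (N : nat) (p : R) (b : {ffun 'I_N -> bool}) :
  \prod_(i < N) bernoulli_pmf p (b i) =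
  p ^+ (\sum_(i < N) b i) * (1 - p) ^+ (N - \sum_(i < N) b i).
Proof.
have -> : (N - \sum_(i < N) b i = \sum_(i < N) ~~ b i)%N.
  rewrite -[X in (X - _)%N](card_ord N) -sum1_card.
  rewrite (eq_bigr (fun i => b i + ~~ b i)%N); last by move=> i _; case: (b i).
  by rewrite big_split/= addKn.
rewrite -!prodrXr -big_split/=; apply: eq_bigr => i _.
by rewrite /bernoulli_pmf; case: (b i); rewrite ?expr0 ?expr1 ?mulr1 ?mul1r.
Qed.

Lemma sum_prod_bernoulli_pmf (R : realType) (N : nat) (p : R) :
  \sum_(b : {ffun 'I_N -> bool}) \prod_(i < N) bernoulli_pmf p (b i) = 1.
Proof.
rewrite -(bigA_distr_bigA (fun=> bernoulli_pmf p)) big1// => i _.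
by rewrite big_bool/= addrC subrK.
Qed.

Lemma iid_bernoulli_prefix d (T : measurableType d) (R : realType)
    (P : probability T R) (X : nat -> {RV P >-> bool}) (mu : R) (N : nat)
    (b : nat -> bool) :
  0 <= mu <= 1 -> iid_bernoulli X mu ->
  P (\bigcap_(i in [set` index_iota 0 N]) (X i @^-1` [set b i])) =
  (\prod_(i < N) bernoulli_pmf mu (b i))%:E.
Proof.
move=> mu01 [indX lawX].
rewrite (indX _ (fun i => [set b i]) (iota_uniq _ _))// big_mkord.
rewrite -prodEFin; apply: eq_bigr => i _.
have := congr1 (fun f => f [set b i]) (lawX i).
rewrite /distribution /pushforward => ->; rewrite bernoulli_probE// !diracE.
by case: (b i); rewrite !in_set1/= ?mule1 ?mule0 ?adde0 ?add0e.
Qed.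

(** Union bound over the admissible outcomes of the first [N] samples: their likelihoods under [z]
    add up to at most 1. Since [A] need only be contained in the tail event, it may depend on later
    samples too. *)
Lemma iid_bernoulli_sum_tail d (T : measurableType d) (R : realType)
    (P : probability T R) (X : nat -> {RV P >-> bool}) (mu : R) (g N : nat)
    (A : set T) :
  0 < mu < 1 -> (0 < g <= N)%N -> iid_bernoulli X mu -> measurable A ->
  (forall w, A w ->
    0 <= ((\sum_(i < N) X i w)%N%:R - g%:R) * (g%:R / N%:R - mu)) ->
  (P A <= (expR (g%:R * H (g%:R / N%:R) mu))%:E)%E.
Proof.
move=> mu01 gN iidX mA sumA; set z := g%:R / N%:R; set C := expR _.
pose ext (b : {ffun 'I_N -> bool}) i := oapp b false (insub i).
have extE b (i : 'I_N) : ext b i = b i by rewrite /ext valK.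
pose F b := \bigcap_(i in [set` index_iota 0 N]) (X i @^-1` [set ext b i]).
pose D (b : {ffun 'I_N -> bool}) := 0 <= ((\sum_(i < N) b i)%N%:R - g%:R) * (z - mu).
have mF b : measurable (F b).
  by apply: fin_bigcap_measurable => // i _; exact: measurable_funPTI.
have AF : A `<=` \bigcup_(b in [set` enum D]) F b.
  move=> w Aw; pose b := [ffun i : 'I_N => X i w]; exists b.
    rewrite /= mem_enum unfold_in /D.
    by under eq_bigr do rewrite ffunE; exact: sumA.
  move=> i /=; rewrite mem_index_iota/= => iN.
  by have := extE b (Ordinal iN); rewrite /= => ->; rewrite ffunE.
apply: le_trans (content_sub_fsum P _ _ mA AF) _ => //.
rewrite -fsbig_seq ?enum_uniq// big_enum/=.
have mu01' : 0 <= mu <= 1 by case/andP: mu01 => /ltW -> /ltW ->.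
under eq_bigr => b _.
  rewrite (iid_bernoulli_prefix _ _ mu01' iidX); under eq_bigr do rewrite extE.
  over.
rewrite sumEFin lee_fin.
have z0 : 0 <= z by rewrite divr_ge0.
have z1 : z <= 1.
  case/andP: gN => g0 gN; rewrite ler_pdivrMr ?mul1r ?ler_nat// ltr0n.
  exact: leq_trans gN.
apply: (@le_trans _ _ (\sum_(b | D b) C * \prod_(i < N) bernoulli_pmf z (b i))).
  apply: ler_sum => b Db; rewrite !prod_bernoulli_pmf; apply: likelihood_le => //.
  by rewrite -[leqRHS](card_ord N) -sum1_card leq_sum// => i _; case: (b i).
rewrite -mulr_sumr ler_piMr ?expR_ge0// -[leRHS](sum_prod_bernoulli_pmf N z).
rewrite [leRHS](bigID D)/= lerDl sumr_ge0// => b _.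
by rewrite prodr_ge0// => i _; rewrite bernoulli_pmf_ge0// z0.
Qed.

(** An arbitrary predicate lets the induction absorb the last sample by shifting [p]. *)
Lemma measurable_sum_RV_bool d (T : measurableType d) (R : realType)
    (P : probability T R) (X : nat -> {RV P >-> bool}) (N : nat) (p : pred nat) :
  measurable [set w | p (\sum_(i < N) X i w)%N].
Proof.
elim: N p => [|N IH] p.
  under eq_set do rewrite big_ord0.
  by case: (p 0); rewrite ?set_true ?set_false.
pose XN (b : bool) := X N @^-1` [set b].
rewrite (_ : [set w | _] =
    (XN true `&` [set w | p (\sum_(i < N) X i w).+1%N]) `|`
    (XN false `&` [set w | p (\sum_(i < N) X i w)%N])).
  apply: measurableU; apply: measurableI.
  - exact: measurable_funPTI.
  - exact: (IH (fun k => p k.+1)).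
  - exact: measurable_funPTI.
  - exact: IH.
apply/seteqP; split=> w; rewrite /= big_ord_recr/= /XN/=.
  by case: (X N w); rewrite ?addn1 ?addn0; [left|right].
by case=> [[->]|[->]]; rewrite ?addn1 ?addn0.
Qed.

(** * The stopping size and its partial sums *)

Lemma leq_sum_ord_le (x : nat -> bool) (m n : nat) : (m <= n)%N ->
  (\sum_(i < m) x i <= \sum_(i < n) x i)%N.
Proof.
move=> mn; rewrite (big_ord_widen n (fun i => x i : nat) mn) big_mkcond.
by rewrite leq_sum// => i _; case: ifP.
Qed.

Lemma inverse_sample_size_Some (x : nat -> bool) (g n : nat) : (0 < g)%N ->
  inverse_sample_size x g = Some n ->
  [/\ (g <= n)%N, (g <= \sum_(i < n) x i)%N &
      forall m, (m <= n)%N -> (\sum_(i < m) x i <= g)%N].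
Proof.
move=> g0; rewrite /inverse_sample_size; case: pselect => // h [<-].
case: ex_minnP => k /andP[k0 gk] kmin; split=> //.
  apply: leq_trans gk _; rewrite -[leqRHS](card_ord k) -sum1_card leq_sum// => i _.
  by case: (x i).
(* Minimality concerns positive sizes only, so size 1, whose predecessor is 0, is settled by
   [0 < g]. Beyond that, the sum before the last sample is below [g] and one sample adds at most
   1. *)
move=> [|[|m]] mk; first by rewrite big_ord0.
  by rewrite big_ord1 (leq_trans _ g0)//; case: (x _).
rewrite big_ord_recr/= (@leq_trans (\sum_(i < m.+1) x i).+1)//.
  by rewrite -[leqRHS]addn1 leq_add2l; case: (x _).
by rewrite ltnNge; apply/negP => gm; have := kmin m.+1 gm; rewrite leqNgt mk.
Qed.

Lemma inverse_sample_size_None (x : nat -> bool) (g n : nat) : (0 < g)%N ->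
  inverse_sample_size x g = None -> (\sum_(i < n) x i < g)%N.
Proof.
move=> g0; rewrite /inverse_sample_size; case: pselect => // h _.
case: n => [|n]; first by rewrite big_ord0.
by rewrite ltnNge; apply/negP => gn; apply: h; exists n.+1.
Qed.

(** Along [n = g * k] the ratio is [1 / k], and the term [(k - 1) * ln (1 - m)] of [H] decreases
    linearly in [k], which beats the growth of [ln k]. *)
Lemma H_unbounded_below (R : realType) (m L : R) (g : nat) :
  0 < m < 1 -> (0 < g)%N ->
  exists n, [&& (g <= n)%N, g%:R / n%:R < m & H (g%:R / n%:R) m <= L].
Proof.
move=> m01 g0; have /andP[m0 m1] := m01.
(* The linear decay has slope [2 * a]. Half of it pays for [ln k], through the tangent bound
   [ln k <= a * k - 1 - ln a]; the other half brings [H] below [L] once [k >= A]. *)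
pose a := - ln (1 - m) / 2.
have a0 : 0 < a.
  by rewrite divr_gt0// oppr_gt0 ln_lt0// subr_gt0 m1 gtrBl.
pose A := (ln m - ln a + 2 * a - L) / a.
pose k := (Num.bound `|A| + Num.bound m^-1)%N.
have Ak : A <= k%:R.
  rewrite natrD (le_trans (ler_norm A))//.
  by rewrite (le_trans (ltW (archi_boundP (normr_ge0 A))))// lerDl.
have mk : m^-1 < k%:R.
  by rewrite natrD (lt_le_trans (archi_boundP _)) ?lerDr// invr_ge0 ltW.
have k1 : 1 < k%:R :> R by rewrite (lt_trans _ mk)// invf_gt1.
have k0 : 0 < k%:R :> R by rewrite (lt_trans _ k1).
have zE : g%:R / (g * k)%:R = k%:R^-1 :> R.
  by rewrite natrM invfM mulrA divff ?mul1r// pnatr_eq0 -lt0n.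
have z01 : 0 < (k%:R^-1 : R) < 1 by rewrite invr_gt0 k0 invf_lt1.
exists (g * k)%N; rewrite zE; apply/and3P; split.
- by rewrite leq_pmulr// -(ltr_nat R).
- by rewrite invf_plt ?posrE.
rewrite H_lnE//; last by case/andP: z01 => -> /ltW ->.
have /andP[z0 z1] := z01.
have lnz : - ln (1 - k%:R^-1) <= (k%:R - 1)^-1 :> R.
  have := @ln_sub_le R 1 (1 - k%:R^-1) ltr01.
  rewrite subr_gt0 ln1 sub0r => /(_ z1)/le_trans; apply.
  rewrite le_eqVlt; apply/orP; left; apply/eqP; field.
  by rewrite subr_eq0 !gt_eqF.
have lnk : ln (k%:R : R) <= a * k%:R - 1 - ln a.
  have ak0 : 0 < a * k%:R by rewrite mulr_gt0.
  have := ln_sub_le ak0 ltr01.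
  by rewrite lnM ?posrE// ln1 subr0 divr1; lra.
rewrite lnV ?posrE// opprK invrK.
have e1 : (k%:R - 1) * - ln (1 - k%:R^-1) <= 1 :> R.
  by rewrite mulrC -ler_pdivlMr ?subr_gt0// div1r.
have e2 : ln (1 - m) = - (2 * a) by rewrite /a; field.
rewrite e2.
have : ln m - ln a + 2 * a - L <= k%:R * a by rewrite -ler_pdivrMr.
lra.
Qed.

Theorem theorem2 (d : measure_display) (T : measurableType d) (R : realType)
    (P : probability T R) (X : nat -> {RV P >-> bool})
    (mu delta : R) (gamma : nat)
    (mu_upper mu_lower : {RV P >-> R}) :
  0 < mu < 1 ->
  0 < delta < 1 ->
  (0 < gamma)%N ->
  iid_bernoulli X mu ->
  (forall (w : T) (n : nat),
     inverse_sample_size (fun i => X i w) gamma = Some n ->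
     n = gamma -> mu_upper w = 1) ->
  (forall (w : T) (n : nat),
     inverse_sample_size (fun i => X i w) gamma = Some n ->
     (gamma < n)%N ->
     H (gamma%:R / n%:R) (mu_upper w) = ln (delta / 2) / gamma%:R /\
     gamma%:R / n%:R < mu_upper w < 1) ->
  (forall (w : T) (n : nat),
     inverse_sample_size (fun i => X i w) gamma = Some n ->
     H (gamma%:R / n%:R) (mu_lower w) = ln (delta / 2) / gamma%:R /\
     0 < mu_lower w < gamma%:R / n%:R) ->
  ((1 - delta)%:E <= P [set w | (mu_lower w < mu < mu_upper w)%R])%E.
Proof.
move=> mu01 /andP[delta0 delta1] g0 iidX upper1 upperH lowerH.
have /andP[mu0 mu1] := mu01.
have g0' : 0 < gamma%:R :> R by rewrite ltr0n.
set L := ln (delta / 2) / gamma%:R in upperH lowerH *.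
have expL h : h <= L -> expR (gamma%:R * h) <= delta / 2.
  move=> hL; rewrite -[leRHS]lnK ?posrE ?divr_gt0// ler_expR.
  by rewrite mulrC -ler_pdivlMr.
have z01 n : (gamma <= n)%N -> 0 < (gamma%:R / n%:R : R) <= 1.
  move=> gn; have n0 : 0 < n%:R :> R by rewrite ltr0n (leq_trans g0).
  by rewrite divr_gt0// ler_pdivrMr ?mul1r ?ler_nat.
set G := [set w | _].
have mG : measurable G.
  rewrite (_ : G = mu_lower @^-1` `]-oo, mu[ `&` mu_upper @^-1` `]mu, +oo[).
    by apply: measurableI; apply: measurable_funPTI; exact: measurable_itv.
  by apply/seteqP; split=> w /=; rewrite !in_itv/= andbT => /andP.
have [N /and3P[gN Nmu HN] Nmin] := ex_minnP (H_unbounded_below L mu01 g0).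
pose E := [set w | (\sum_(i < N) X i w <= gamma)%N].
have mE : measurable E by exact: (measurable_sum_RV_bool X N (leq^~ gamma)).
have PE : (P E <= (delta / 2)%:E)%E.
  apply: (@le_trans _ _ (expR (gamma%:R * H (gamma%:R / N%:R) mu))%:E).
    apply: (iid_bernoulli_sum_tail mu01 _ iidX) => //; first by rewrite g0.
    by move=> w; rewrite /E/= => Sg; rewrite mulr_le0// subr_le0 ?ler_nat// ltW.
  by rewrite lee_fin expL.
(* Once [E] is removed, sampling stops and a failure can only come from [mu <= mu_lower]. *)
pose V := ~` G `\` E.
have mV : measurable V by apply: measurableD => //; exact: measurableC.
pose Q n := [&& (gamma <= n)%N, mu < gamma%:R / n%:R & H (gamma%:R / n%:R) mu <= L].
have VQ w : V w -> exists n, Q n /\ (gamma <= \sum_(i < n) X i w)%N.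
  move=> [notG notE]; case nE : (inverse_sample_size (X^~ w) gamma) => [n|]; last first.
    by exfalso; apply: notE; apply: ltnW; exact: inverse_sample_size_None g0 nE.
  have [gn Sn leSg] := inverse_sample_size_Some g0 nE.
  exists n; split => //; have [Hl /andP[l0 lz]] := lowerH w n nE.
  have /andP[z0 z1] := z01 n gn.
  have mul : mu <= mu_lower w.
    rewrite leNgt; apply/negP => lmu; apply: notG; rewrite /G/= lmu/=.
    (* If [n = gamma], the upper limit is 1 and exceeds [mu]. Otherwise [mu_upper <= mu] would give
       [N <= n], and partial sums up to the stopping size never exceed [gamma], so [w] would lie in
       [E]. *)
    move: gn; rewrite leq_eqVlt => /predU1P[gn|gn]; first by rewrite (upper1 w n nE).
    have [Hu /andP[zu u1]] := upperH w n nE gn.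
    rewrite ltNge; apply/negP => umu; apply: notE.
    have Nn : (N <= n)%N.
      apply: Nmin; rewrite ltnW//= (lt_le_trans zu umu)/= -Hu.
      apply: H_le => //; rewrite ?z0// ?u1 ?(lt_trans z0 zu)//.
      by rewrite mulr_ge0// subr_ge0// ltW.
    exact: leSg.
  rewrite /Q gn/= (le_lt_trans mul lz)/= -Hl.
  apply: H_le => //; rewrite ?z0// ?l0 ?(lt_le_trans lz z1)//.
  by rewrite mulr_le0// subr_le0// ltW.
have PV : (P V <= (delta / 2)%:E)%E.
  (* No size need satisfy [Q], but then [V] is empty. Otherwise a largest one exists, as
     [mu < gamma / n] bounds [n] by [gamma / mu]. *)
  have [exQ|nQ] := pselect (exists n, Q n); last first.
    rewrite (_ : V = set0) ?measure0 ?lee_fin ?divr_ge0 ?(ltW delta0)//.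
    by apply/seteqP; split=> // w /VQ[n [Qn _]]; apply: nQ; exists n.
  have bQ n : Q n -> (n <= Num.bound (gamma%:R / mu))%N.
    move=> /and3P[gn mun _]; rewrite -(ler_nat R) ltW//.
    rewrite (lt_trans _ (archi_boundP _)) ?divr_ge0 ?ltW// ltr_pdivlMr//.
    by rewrite mulrC -ltr_pdivlMr// ltr0n (leq_trans g0).
  have [M /and3P[gM Mmu HM] Mmax] := ex_maxnP exQ bQ.
  apply: (@le_trans _ _ (expR (gamma%:R * H (gamma%:R / M%:R) mu))%:E); last first.
    by rewrite lee_fin expL.
  apply: (iid_bernoulli_sum_tail mu01 _ iidX) => //; first by rewrite g0.
  move=> w /VQ[n [Qn Sn]]; rewrite mulr_ge0 ?subr_ge0 ?(ltW Mmu)// ler_nat.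
  exact: leq_trans Sn (leq_sum_ord_le (X^~ w) (Mmax n Qn)).
have : (P (~` G) <= delta%:E)%E.
  apply: (@le_trans _ _ (P (E `|` V))).
    apply: le_measure; rewrite ?inE//; [exact: measurableC|exact: measurableU|].
    by move=> w Gw; have [Ew|Ew] := pselect (E w); [left|right].
  apply: le_trans (measureU2 _ mE mV) _.
  by rewrite (splitr delta) EFinD leeD.
rewrite probability_setC// leeBlDr ?fin_num_measure// EFinB leeBlDr//.
by rewrite addeC.
Qed.
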